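(* Let $n$ be a nonnegative integer, let $A_n=\sum_{k=0}^n\binom nk^2\binom{n+k}k^2$ and $\beta_n=\sum_{k=0}^{n}\binom{n}{k}^2\binom{n+k}{k}$. If $A_n\equiv 8j+4i+1\pmod{16}$ with $i,j\in\{0,1\}$, then $\beta_n\equiv 2(i+j)+1\pmod 4$. *)

(* Defs.v *)
From mathcomp Require Import all_boot.

Set Implicit Arguments.
Unset Strict Implicit.
Unset Printing Implicit Defensive.

(* The two families of Apery numbers, attached to zeta(3) and zeta(2)
   respectively; the sums run over 0 <= k <= n. *)
Definition apery_A (n : nat) : nat :=
  \sum_(k < n.+1) 'C(n, k) ^ 2 * 'C(n + k, k) ^ 2.

Definition apery_beta (n : nat) : nat :=
  \sum_(k < n.+1) 'C(n, k) ^ 2 * 'C(n + k, k).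

(* Main.v *)
Require Import Defs.
From mathcomp Require Import all_boot.
From mathcomp Require Import zify.

(** Put [c_k = 'C(2k, k) / 2], which for [k > 0] is odd iff [k] is a power of 2.
    Since ['C(n, k) 'C(n+k, k) = 'C(n+k, 2k) 'C(2k, k)], the numbers are
    [A_n = 1 + 4 \sum_k ('C(n+k, 2k) c_k)^2] and
    [beta_n = 1 + 2 \sum_k 'C(n, k) 'C(n+k, 2k) c_k].  As [x^2] is 0 or 1 mod 4,
    the residues of [A_n] mod 16 and [beta_n] mod 4 only depend on the numbers
    [N] and [B] of odd terms.  By Lucas, ['C(n+2^m, 2^(m+1))] is odd iff bits [m]
    and [m+1] of [n] differ, so [N] counts the changes of digit in the binary
    expansion of [n] and [B] its blocks of ones; hence [N + (n mod 2) = 2 B]. *)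

(** Mod 2, [(1 + x)^(2n)] is [(1 + x^2)^n]. Pascal's rule applied twice mixes both parities of the
    lower index, so they share one induction. *)
Lemma odd_bin_double (n k : nat) :
  (odd 'C(n.*2, k.*2) = odd 'C(n, k)) * (odd 'C(n.*2, k.*2.+1) = false).
Proof.
elim: n k => [|n IHn] [|k]; rewrite ?bin0 //.
  by rewrite doubleS !binS !bin0 !oddD (IHn 0).2 addbb.
rewrite !doubleS !binS !oddD -doubleS !IHn.
by rewrite addbF addFb addbb.
Qed.

Lemma odd_bin_doubleS (n k : nat) :
  (odd 'C(n.*2.+1, k.*2) = odd 'C(n, k)) *
  (odd 'C(n.*2.+1, k.*2.+1) = odd 'C(n, k)).
Proof.
split; last by rewrite binS oddD !odd_bin_double.
case: k => [|k]; first by rewrite !bin0.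
by rewrite doubleS binS oddD -doubleS !odd_bin_double addbF.
Qed.

Lemma odd_bin_half (n k : nat) : odd 'C(n, k.*2) = odd 'C(n./2, k).
Proof.
rewrite -{1}(odd_double_half n); case: (odd n).
  by rewrite add1n odd_bin_doubleS.
by rewrite add0n odd_bin_double.
Qed.

Lemma bin_centralS (k : nat) : 'C(k.+1.*2, k.+1) = 'C(k.*2.+1, k).*2.
Proof.
rewrite doubleS binS -[RHS]addnn; congr (_ + _).
by rewrite -(bin_sub (n := k.*2.+1)); [congr 'C(_, _); lia | lia].
Qed.

Lemma half_bin_centralS (k : nat) : 'C(k.+1.*2, k.+1)./2 = 'C(k.*2.+1, k).
Proof. by rewrite bin_centralS doubleK. Qed.

Lemma bin_central_half (k : nat) :
  'C(k.*2, k) = (k == 0) + 'C(k.*2, k)./2.*2.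
Proof. by case: k => [|k] //; rewrite half_bin_centralS bin_centralS. Qed.

Lemma odd_half_bin_central_double (k : nat) :
  odd 'C(k.*2.*2, k.*2)./2 = odd 'C(k.*2, k)./2.
Proof.
case: k => [|k]; first by [].
rewrite [k.+1.*2 in LHS]doubleS !half_bin_centralS.
by rewrite odd_bin_doubleS.
Qed.

(** Here [c_(2k+1) = 'C(4k+1, 2k)] has the parity of ['C(2k, k)], which is even for [k > 0]. *)
Lemma odd_half_bin_central_doubleS (k : nat) :
  odd 'C(k.*2.+1.*2, k.*2.+1)./2 = (k == 0).
Proof.
rewrite half_bin_centralS odd_bin_doubleS bin_central_half oddD odd_double.
by case: eqP.
Qed.

Lemma bin_mul_bin_central (n k : nat) :
  'C(n, k) * 'C(n + k, k) = 'C(n + k, k.*2) * 'C(k.*2, k).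
Proof.
case: (leqP k n) => [le_kn | lt_nk]; last first.
  by rewrite bin_small // [X in _ = X * _]bin_small //; lia.
have e1 := bin_fact le_kn; have e2 := bin_fact (leq_addl n k).
have e3 := @bin_fact k.*2 k ltac:(lia).
have e4 := @bin_fact (n + k) k.*2 ltac:(lia).
rewrite addnK in e2; rewrite -addnn addnK addnn in e3.
rewrite -addnn subnDr addnn in e4.
have pos : 0 < k`! * k`! * (n - k)`! by rewrite !muln_gt0 !fact_gt0.
(* Multiplied by [k!^2 (n-k)! n!], both sides become [n! (n+k)!]. *)
apply/eqP; rewrite -(eqn_pmul2r pos) -(eqn_pmul2r (fact_gt0 n)); apply/eqP.
nia.
Qed.

Lemma sum_nat_double (F : nat -> nat) (m : nat) :
  \sum_(0 <= k < m.*2) F k = \sum_(0 <= k < m) (F k.*2 + F k.*2.+1).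
Proof.
elim: m => [|m IHm]; first by rewrite !big_geq.
by rewrite doubleS !big_nat_recr //= IHm addnA.
Qed.

Definition A_term (n k : nat) : nat := 'C(n + k, k.*2) * 'C(k.*2, k)./2.

Lemma A_term_small (n k : nat) : n < k -> A_term n k = 0.
Proof. by move=> lt_nk; rewrite /A_term bin_small //; lia. Qed.

Lemma odd_A_term_double (n k : nat) : odd (A_term n k.*2) = odd (A_term n./2 k).
Proof.
rewrite /A_term !oddM odd_half_bin_central_double odd_bin_half.
by rewrite halfD odd_double andbF add0n doubleK.
Qed.

Lemma odd_A_term_doubleS (n k : nat) :
  odd (A_term n k.*2.+1) = (k == 0) && (odd n (+) odd n./2).
Proof.
rewrite /A_term oddM odd_half_bin_central_doubleS andbC.
(* At [k = 0] the binomial is ['C(n+1, 2)], odd iff [(n+1)./2] is, that is, iff [n] is 1 or 2 mod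
   4. *)
case: k => [|k] //=; rewrite (odd_bin_half _ 1) bin1; lia.
Qed.

Definition odd_A_terms (n : nat) : nat := \sum_(0 <= k < n.+1) odd (A_term n k).

Definition odd_beta_terms (n : nat) : nat :=
  \sum_(0 <= k < n.+1) odd ('C(n, k) * A_term n k).

Lemma sum_nat_widen (F : nat -> nat) (n m : nat) :
  n <= m -> (forall k, n <= k -> F k = 0) ->
  \sum_(0 <= k < m) F k = \sum_(0 <= k < n) F k.
Proof.
move=> le_nm F0; rewrite (big_cat_nat (n := n)) //=.
by rewrite addnC big_nat big1 // => k /andP[/F0].
Qed.

Lemma odd_A_terms_half (n : nat) :
  odd_A_terms n = odd_A_terms n./2 + (odd n (+) odd n./2).
Proof.
(* The new bound is [n+1] or [n+2]: it is even, so the range splits into pairs, and any added term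
   vanishes. *)
rewrite /odd_A_terms -(@sum_nat_widen _ n.+1 n./2.+1.*2); first last.
- by move=> k lt_nk; rewrite A_term_small.
- lia.
rewrite sum_nat_double big_split /=; congr (_ + _).
  by apply: eq_bigr => k _; rewrite odd_A_term_double.
rewrite big_nat_recl // odd_A_term_doubleS big1 ?addn0 // => k _.
by rewrite odd_A_term_doubleS.
Qed.

(** Among odd indices only 1 contributes, and its factor ['C(n, 1)] keeps only odd [n]: one is added
    exactly when the last binary digit opens a new block of ones. *)
Lemma odd_beta_terms_half (n : nat) :
  odd_beta_terms n = odd_beta_terms n./2 + (odd n && ~~ odd n./2).
Proof.
rewrite /odd_beta_terms -(@sum_nat_widen _ n.+1 n./2.+1.*2); first last.
- by move=> k lt_nk; rewrite A_term_small ?muln0.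
- lia.
rewrite sum_nat_double big_split /=; congr (_ + _).
  by apply: eq_bigr => k _; rewrite [in LHS]oddM [in RHS]oddM odd_A_term_double odd_bin_half.
rewrite big_nat_recl // oddM odd_A_term_doubleS big1 => [|k _]; last first.
  by rewrite oddM odd_A_term_doubleS andbF.
by rewrite bin1 addn0 /=; case: odd.
Qed.

(** Each block of ones has a change of digit at both ends, except that a block reaching the last
    digit lacks the lower one; [odd n] supplies it. *)
Lemma odd_A_terms_beta (n : nat) : odd_A_terms n + odd n = (odd_beta_terms n).*2.
Proof.
elim/ltn_ind: n => -[|n] IHn.
  by rewrite /odd_A_terms /odd_beta_terms !big_nat1.
rewrite odd_A_terms_half odd_beta_terms_half.
have /IHn : n.+1./2 < n.+1 by lia.
lia.
Qed.

Lemma apery_A_term_sum (n : nat) :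
  apery_A n = 1 + 4 * \sum_(0 <= k < n.+1) A_term n k ^ 2.
Proof.
rewrite /apery_A -(big_mkord xpredT (fun k => 'C(n, k) ^ 2 * 'C(n + k, k) ^ 2)).
(* The summand at [k = 0] is the leading 1, while [A_term n 0 = 0] since [1./2 = 0]. *)
rewrite !(big_nat_recl n) //= !bin0 /A_term /= muln0 add0n mul1n; congr (_ + _).
rewrite big_distrr /=; apply: eq_bigr => k _.
by rewrite -expnMn bin_mul_bin_central {1}[X in _ * X]bin_central_half /=; lia.
Qed.

Lemma apery_beta_term_sum (n : nat) :
  apery_beta n = 1 + 2 * \sum_(0 <= k < n.+1) 'C(n, k) * A_term n k.
Proof.
rewrite /apery_beta -(big_mkord xpredT (fun k => 'C(n, k) ^ 2 * 'C(n + k, k))).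
rewrite !(big_nat_recl n) //= !bin0 /A_term /= muln0 add0n mul1n; congr (_ + _).
rewrite big_distrr /=; apply: eq_bigr => k _.
rewrite -mulnn -mulnA bin_mul_bin_central {1}[X in _ * (_ * X)]bin_central_half /=.
lia.
Qed.

Lemma sum_modn (F G : nat -> nat) (d m n : nat) :
  (forall k, F k = G k %[mod d]) ->
  \sum_(m <= k < n) F k = \sum_(m <= k < n) G k %[mod d].
Proof.
move=> FG; rewrite -modn_summ -[RHS]modn_summ; congr (_ %% _).
by apply: eq_bigr => k _.
Qed.

Lemma sqrn_mod4 (x : nat) : x ^ 2 = odd x %[mod 4].
Proof.
rewrite -{1}(odd_double_half x); case: (odd x) => /=; last first.
  by rewrite add0n -mul2n expnMn modnMr.
by rewrite (_ : _ ^ 2 = (x./2 ^ 2 + x./2) * 4 + 1) ?modnMDl //; lia.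
Qed.

Theorem theorem1p3 (n i j : nat)
    (hi : i \in [:: 0; 1]) (hj : j \in [:: 0; 1])
    (hA : apery_A n = 8 * j + 4 * i + 1 %[mod 16]) :
  apery_beta n = 2 * (i + j) + 1 %[mod 4].
Proof.
have hN := odd_A_terms_beta n.
have hS : \sum_(0 <= k < n.+1) A_term n k ^ 2 = odd_A_terms n %[mod 4].
  by apply: sum_modn => k; apply: sqrn_mod4.
have hT : \sum_(0 <= k < n.+1) 'C(n, k) * A_term n k = odd_beta_terms n %[mod 2].
  by apply: sum_modn => k; rewrite modn2 modn_small //; case: odd.
move: hA; rewrite apery_A_term_sum apery_beta_term_sum.
(* The hypothesis gives [N = 2j + i] mod 4, so [n] has the parity of [i]; then
   [2B = N + odd n = 2(i + j)] mod 4 fixes [B] mod 2. *)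
move: hi hj; rewrite !inE => /orP[] /eqP -> /orP[] /eqP ->; lia.
Qed.
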